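(* Let $n\ge 1$, let $\widetilde G=K_n$ be the complete graph on $n$ vertices, and let $G$ be the bunkbed graph of $\widetilde G$. For all vertices $x,y$ of $K_n$, $$\mathbb{P}_{\frac12}\big((x,0)\leftrightarrow(y,0)\big)\;\ge\;\mathbb{P}_{\frac12}\big((x,0)\leftrightarrow(y,1)\big).$$
   Context: The bunkbed graph of a graph $\widetilde G=(\widetilde V,\widetilde E)$ is the graph $G=(V,E)=\widetilde G\times\{0,1\}$: its vertex set is $\widetilde V\times\{0,1\}$, and its edges are the edges $\{(x,i),(y,i)\}$ for $\{x,y\}\in\widetilde E$ and $i\in\{0,1\}$, together with the vertical edges $\{(x,0),(x,1)\}$ for every $x\in\widetilde V$. Percolation: each edge of $E$ (including the vertical ones) is independently open with probability $p$ and closed with probability $1-p$; $\mathbb{P}_p$ denotes the resulting law on $\{0,1\}^E$. For $u,v\in V$, $u\leftrightarrow v$ denotes the event that there is a path of open edges between $u$ and $v$; by convention $u\leftrightarrow u$ always holds. *)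

(* Defs.v *)
From HB Require Import structures.
From mathcomp Require Import all_boot all_order all_algebra.

Set Implicit Arguments.
Unset Strict Implicit.
Unset Printing Implicit Defensive.

Import Order.TTheory GRing.Theory Num.Theory.
Local Open Scope ring_scope.

(* A finite simple graph is given by its adjacency relation, a symmetric and
   irreflexive [rel T] on a finite type [T]. *)

Definition complete_rel (n : nat) : rel 'I_n := [rel x y | x != y].

(* The levels 0 and 1 are encoded as [false] and [true]. *)
Definition bunkbed_rel (T : finType) (e : rel T) : rel (T * bool) :=
  [rel u v | (e u.1 v.1 && (u.2 == v.2)) || ((u.1 == v.1) && (u.2 != v.2))].

(* Edges are unordered pairs, so that each one carries a single state. *)
Definition edge_set (T : finType) (e : rel T) : {set {set T}} :=
  [set [set u.1; u.2] | u : T * T & e u.1 u.2].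

Definition edge (T : finType) (e : rel T) : finType :=
  {f : {set T} | f \in edge_set e}.

(* {0,1}^E, with [true] meaning open. *)
Definition config (T : finType) (e : rel T) : finType := {ffun edge e -> bool}.

Definition open_rel (T : finType) (e : rel T) (w : config e) : rel T :=
  [rel u v | [exists f : edge e, (val f == [set u; v]) && w f]].

Definition connected_in (T : finType) (e : rel T) (u v : T) :
    pred (config e) :=
  [pred w | connect (open_rel w) u v].

Definition perc_weight (R : realFieldType) (T : finType) (e : rel T) (p : R)
    (w : config e) : R :=
  \prod_(f : edge e) (if w f then p else 1 - p).

Definition perc_prob (R : realFieldType) (T : finType) (e : rel T) (p : R)
    (A : pred (config e)) : R :=
  \sum_(w : config e | A w) perc_weight p w.

(* Main.v *)
Require Import Defs.
From HB Require Import structures.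
From mathcomp Require Import all_boot all_order all_algebra.
From mathcomp Require Import zify ring.

Set Implicit Arguments.
Unset Strict Implicit.
Unset Printing Implicit Defensive.

Import Order.TTheory GRing.Theory Num.Theory.
Local Open Scope nat_scope.

(** Let x and y be distinct.  At p = 1/2 every configuration has the same
    weight, so the claim compares two cardinals.  Write W(C) for the number of
    configurations having C as a cluster, and classify the clusters containing
    (x,0) by which copies of x and y they contain.  Clusters containing both
    copies of y count on both sides.  Exchanging the two levels shows that the
    clusters containing both copies of x and one copy of y contribute equally
    to the two sides.  What is left is to compare the sets C with x present at
    level 0 only and y at level 1 only (call them mixed) with those where both
    are present at level 0 only.

    Let X(C) and Y(C) be obtained from a mixed C by moving x, respectively y,
    to the other level.  As C ranges over the mixed sets, Y(C) ranges over the
    sets with both vertices at level 0 only, and X(C) over those with both at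
    level 1 only, which have the same total W after exchanging levels.  Hence
    it is enough that 2 W(C) <= W(X(C)) + W(Y(C)) for each mixed C
    (clusters_convex).

    This follows from clusters_turn: let z be a vertex present in C at only one
    level, where C has a vertices, and suppose that C has b >= a vertices at
    the other level; then moving z there does not decrease W, and at least
    doubles it if a < b.  So if the levels of a mixed C have different sizes,
    one of the two moves already gives the bound, and otherwise each move gives
    half of it.  To prove clusters_turn, call a configuration sealed by C if
    all edges leaving C are closed and some vertical edge inside C is open.
    The move makes the edge boundary smaller by 2(b - a + 1) edges and leaves
    the vertical edges inside C as they are, so it multiplies the number
    of sealed configurations by at least 4^(b - a + 1).  On the other hand W
    agrees with that number up to a factor of 4:
    - if C is a cluster meeting both levels, the configuration is sealed, and
    - among sealed configurations at least one in four has C as a cluster,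
      because a graph or its complement is connected: complementing the
      configuration inside one level of C preserves sealedness, so at least
      half of the sealed configurations connect that level by itself, and the
      two levels can be treated one after the other. *)

(** * Preliminaries on relations and finite sets *)

Lemma connect_or_complement (T : finType) (A : {set T}) (r s : rel T) :
    symmetric r -> {in A &, forall u v, u != v -> r u v || s u v} ->
  {in A &, forall u v, connect r u v} \/ {in A &, forall u v, connect s u v}.
Proof.
move=> r_sym rs.
have rC := sym_connect_sym r_sym.
have sE u v : u \in A -> v \in A -> ~~ connect r u v -> connect s u v.
  move=> uA vA nuv; have [eq_uv|ne_uv] := eqVneq u v.
    by rewrite eq_uv connect0 in nuv.
  case/orP: (rs u v uA vA ne_uv) => [ruv|/connect1 //].
  by rewrite connect1 in nuv.
have [all_r|] := boolP [forall u in A, forall v in A, connect r u v].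
  by left=> u v uA vA; move/forall_inP/(_ u uA)/forall_inP: all_r => ->.
rewrite negb_forall_in => /exists_inP[u uA].
rewrite negb_forall_in => /exists_inP[v vA nuv].
(* Two r-connected vertices are joined in s through a vertex c of another
   r-component. *)
right=> a b aA bA; have [rab|] := boolP (connect r a b); last exact: sE.
have [c cA nac] : exists2 c, c \in A & ~~ connect r a c.
  have [rau|] := boolP (connect r a u); last by exists u.
  exists v => //; apply: contra nuv => rav.
  by rewrite rC in rau; apply: connect_trans rau rav.
apply: (connect_trans (sE _ _ aA cA nac)); apply: sE => //.
by apply: contra nac => rcb; rewrite rC in rcb; apply: connect_trans rab rcb.
Qed.

(** Each w in P is itself in Q or is sent into Q by phi, so that two copies of
    P :&: Q cover P. *)
Lemma card_le_double (T : finType) (phi : T -> T) (P Q : {set T}) :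
    injective phi -> {in P, forall w, phi w \in P} ->
    {in P, forall w, (w \in Q) || (phi w \in Q)} ->
  #|P| <= 2 * #|P :&: Q|.
Proof.
move=> phi_inj phiP phiQ; rewrite mul2n -addnn.
rewrite -[X in _ + X](card_preimset _ phi_inj).
apply: leq_trans (leq_card_setU _ _); apply/subset_leq_card/subsetP => w wP.
by rewrite !inE wP phiP //= phiQ.
Qed.

Lemma eq_set2 (T : finType) (a b u v : T) :
  [set a; b] = [set u; v] -> a = u /\ b = v \/ a = v /\ b = u.
Proof.
move=> eq_ab_uv.
have: a \in [set u; v] by rewrite -eq_ab_uv set21.
have: b \in [set u; v] by rewrite -eq_ab_uv set22.
have: u \in [set a; b] by rewrite eq_ab_uv set21.
have: v \in [set a; b] by rewrite eq_ab_uv set22.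
rewrite !in_set2 => /orP[]/eqP-> /orP[]/eqP-> /orP[]/eqP ? /orP[]/eqP ?.
all: by subst; tauto.
Qed.

Lemma card_zero_on (E : finType) (B : {set E}) :
  #|[set w : {ffun E -> bool} | [forall f in B, ~~ w f]]| = 2 ^ #|~: B|.
Proof.
rewrite -card_bool -(card_pffun_on false); apply: eq_card => w.
rewrite inE; apply/forall_inP/pffun_onP => [wB|[/subsetP suppw _] f fB].
  split=> //; apply/subsetP => f; rewrite !inE => wf.
  by apply: contraTN wf => /wB; case: (w f).
by apply: contraTN fB => wf; have := suppw f; rewrite !inE wf; apply.
Qed.

(** * Clusters and cuts of a percolation configuration *)

Section Configurations.

Variables (T : finType) (e : rel T).
Implicit Types (A B C : {set T}) (w : config e) (u v : T) (f : edge e).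

Definition cluster w u : {set T} := [set v | connect (open_rel w) u v].

Definition cluster_configs C : {set config e} :=
  [set w | [exists u, cluster w u == C]].

Definition cut C : {set edge e} :=
  [set f | [exists u in C, exists v in ~: C, val f == [set u; v]]].

Lemma open_rel_sym w : symmetric (open_rel w).
Proof. by move=> u v; rewrite /open_rel /= setUC. Qed.

Lemma connect_open_sym w : connect_sym (open_rel w).
Proof. exact/sym_connect_sym/open_rel_sym. Qed.

Lemma cluster_configsP C w v :
  v \in C -> (w \in cluster_configs C) = (cluster w v == C).
Proof.
move=> vC; rewrite inE; apply/existsP/idP => [[u /eqP defC]|]; last by exists v.
rewrite -defC; apply/eqP/setP => z; rewrite !inE.
apply: same_connect; first exact: connect_open_sym.
by rewrite connect_open_sym; rewrite -defC inE in vC.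
Qed.

Lemma card_connected u v :
  #|@connected_in T e u v|
    = \sum_(C : {set T} | (u \in C) && (v \in C)) #|cluster_configs C|.
Proof.
rewrite -sum1_card (partition_big (fun w => cluster w u)
  (fun C => (u \in C) && (v \in C))) /=; last first.
  by move=> w; rewrite !inE connect0.
apply: eq_bigr => C /andP[uC vC]; rewrite -sum1_card; apply: eq_bigl => w.
rewrite (cluster_configsP _ uC) unfold_in /= andb_idl // => /eqP defC.
by rewrite -defC inE in vC.
Qed.

Lemma cluster_cut_closed C w f :
  w \in cluster_configs C -> f \in cut C -> ~~ w f.
Proof.
move=> wC; rewrite inE => /exists_inP[u uC /exists_inP[v]].
rewrite inE => vC def_f; apply: contra vC => wf.
move: wC; rewrite (cluster_configsP _ uC) => /eqP <-.
by rewrite inE connect1 //=; apply/existsP; exists f; rewrite def_f.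
Qed.

Lemma in_cluster_configs C w u :
    u \in C -> {in C, forall v, connect (open_rel w) u v} ->
    {in cut C, forall f, ~~ w f} ->
  w \in cluster_configs C.
Proof.
move=> uC conC cutC; rewrite (cluster_configsP _ uC) eqEsubset.
apply/andP; split; last by apply/subsetP => v /conC; rewrite inE.
apply/subsetP => v; rewrite inE => con_uv.
suff clC : closed (open_rel w) (mem C) by rewrite -(closed_connect clC con_uv).
apply: intro_closed; first exact: connect_open_sym.
move=> a b /= /existsP[f /andP[def_f wf]] aC; apply: contraLR wf => bC.
apply: cutC; rewrite inE; apply/exists_inP; exists a => //.
by apply/exists_inP; exists b => //; rewrite inE.
Qed.

Hypothesis e_sym : symmetric e.

Lemma edge_set_pair u v : ([set u; v] \in edge_set e) = e u v.
Proof.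
apply/imsetP/idP => [[[a b]]|euv]; last by exists (u, v); rewrite ?inE.
by rewrite inE /= => eab /eq_set2[] [-> ->] //; rewrite e_sym.
Qed.

Lemma edge_is_pair f : exists u v, e u v /\ val f = [set u; v].
Proof.
have /imsetP[[u v] euv ->] := valP f.
by rewrite inE in euv; exists u, v.
Qed.

Lemma exists_edge u v : e u v -> exists f, val f = [set u; v].
Proof.
rewrite -edge_set_pair => uvE.
by exists (exist (fun F => F \in edge_set e) _ uvE).
Qed.

Lemma edge_ends f u v : val f = [set u; v] -> e u v.
Proof. by rewrite -edge_set_pair => <-; apply: valP. Qed.

(** The two ends of a cut edge are told apart by membership in C, so counting
    unordered pairs amounts to counting ordered ones. *)
Lemma card_cut C :
  #|cut C| = #|[set p : T * T | [&& p.1 \in C, p.2 \notin C & e p.1 p.2]]|.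
Proof.
rewrite -(card_imset _ val_inj).
rewrite -[RHS](@card_in_imset _ _ (fun p => [set p.1; p.2])).
  apply: eq_card => F; apply/imsetP/imsetP => [[f]|[[u v]]].
    rewrite inE => /exists_inP[u uC /exists_inP[v]]; rewrite inE => vC.
    move=> /eqP def_f ->; exists (u, v) => //.
    by rewrite inE /= uC vC /=; apply: edge_ends def_f.
  rewrite inE /= => /and3P[uC vC /exists_edge[f def_f]] ->; exists f => //.
  rewrite inE; apply/exists_inP; exists u => //.
  by apply/exists_inP; exists v; rewrite ?inE ?def_f.
move=> [a b] [u v]; rewrite !inE /= => /and3P[aC bC _] /and3P[uC vC _].
by case/eq_set2=> [[-> ->] //|[av _]]; rewrite -av aC in vC.
Qed.

Section Restriction.

Variable A : {set T}.

(** Only edges with both ends in A are allowed, so that being joined does not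
    depend on the states of the other edges; this makes the levels of a
    bunkbed independent of each other. *)
Definition inner_rel w : rel T :=
  [rel u v | [&& u \in A, v \in A & open_rel w u v]].

Definition joined w := [forall u in A, forall v in A, connect (inner_rel w) u v].

Definition flip_inside w : config e := [ffun f => w f (+) (val f \subset A)].

Lemma flip_insideK : involutive flip_inside.
Proof. by move=> w; apply/ffunP => f; rewrite !ffunE addbK. Qed.

Lemma joined_connect w : joined w -> {in A &, forall u v, connect (open_rel w) u v}.
Proof.
move=> /forall_inP wA u v uA vA; have /forall_inP/(_ v vA) := wA u uA.
apply: connect_sub => a b /and3P[_ _]; exact: connect1.
Qed.

(** Inside a clique, flipping replaces the open graph by its complement. *)
Lemma joined_flip w :
  {in A &, forall u v, u != v -> e u v} -> joined w || joined (flip_inside w).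
Proof.
move=> cliqueA; have inner_sym w' : symmetric (inner_rel w').
  by move=> u v; rewrite /inner_rel /= open_rel_sym andbCA.
have [|wA|wA] := @connect_or_complement _ A (inner_rel w)
    (inner_rel (flip_inside w)) (inner_sym _).
- move=> u v uA vA /(cliqueA _ _ uA vA)/exists_edge[f def_f]; rewrite /inner_rel /=.
  rewrite uA vA /=; case wf : (w f); apply/orP; [left | right];
    apply/existsP; exists f; rewrite def_f eqxx ?wf ?ffunE ?wf ?def_f //=.
  by apply/subsetP => z; rewrite !inE => /orP[]/eqP->.
- by apply/orP; left; apply/forall_inP => u uA; apply/forall_inP => v; apply: wA.
by apply/orP; right; apply/forall_inP => u uA; apply/forall_inP => v; apply: wA.
Qed.

End Restriction.

Lemma joined_flip_disjoint A B w :
  [disjoint A & B] -> joined A (flip_inside B w) = joined A w.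
Proof.
move=> disAB; suff eq_inner : inner_rel A (flip_inside B w) =2 inner_rel A w.
  by apply: eq_forallb_in => u _; apply: eq_forallb_in => v _; apply: eq_connect.
move=> u v; rewrite /inner_rel /=; case uA: (u \in A) => //=; congr (_ && _).
apply: eq_existsb => f; apply: andb_id2l => /eqP def_f; rewrite ffunE def_f.
case: subsetP => [sub|_]; last by rewrite addbF.
by have := sub u (set21 u v); rewrite (disjointFr disAB).
Qed.

Section Automorphism.

Variable g : T -> T.
Hypotheses (gK : involutive g) (g_auto : forall u v, e (g u) (g v) = e u v).

Fact edge_image_subproof f : g @: val f \in edge_set e.
Proof.
have [u [v [euv ->]]] := edge_is_pair f.
by rewrite imsetU1 imset_set1 edge_set_pair g_auto.
Qed.

Definition edge_image f : edge e :=
  exist (fun F => F \in edge_set e) (g @: val f) (edge_image_subproof f).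

Lemma val_edge_image f : val (edge_image f) = g @: val f. Proof. by []. Qed.

Definition config_image w : config e := [ffun f => w (edge_image f)].

Lemma edge_imageK : involutive edge_image.
Proof.
move=> f; apply: val_inj; rewrite !val_edge_image -imset_comp (eq_imset _ gK).
by rewrite imset_id.
Qed.

Lemma config_imageK : involutive config_image.
Proof. by move=> w; apply/ffunP => f; rewrite !ffunE edge_imageK. Qed.

Lemma open_rel_image w u v :
  open_rel (config_image w) u v = open_rel w (g u) (g v).
Proof.
have imE u' v' f : val f = [set u'; v'] -> val (edge_image f) = [set g u'; g v'].
  by move=> def_f; rewrite val_edge_image def_f imsetU1 imset_set1.
apply/existsP/existsP => [] [f /andP[/eqP def_f]].
  by rewrite ffunE => wf; exists (edge_image f); rewrite wf (imE u v) ?eqxx.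
move=> wf; exists (edge_image f).
by rewrite ffunE edge_imageK wf (imE (g u) (g v)) // !gK eqxx.
Qed.

Lemma connect_image w u v :
  connect (open_rel (config_image w)) u v = connect (open_rel w) (g u) (g v).
Proof.
have sub w' : {homo g : a b / connect (open_rel (config_image w')) a b
                             >-> connect (open_rel w') a b}.
  move=> a _ /connectP[p path_p ->].
  elim: p a path_p => //= b p IHp a /andP[ab /IHp]; apply: connect_trans.
  by apply: connect1; rewrite -open_rel_image.
apply/idP/idP => [/sub //|].
by rewrite -{1}(config_imageK w) => /sub; rewrite !gK.
Qed.

Lemma card_cluster_configs_image C :
  #|cluster_configs (g @^-1: C)| = #|cluster_configs C|.
Proof.
rewrite -[RHS](card_preimset _ (inv_inj config_imageK)).
apply: eq_card => w; rewrite [RHS]inE.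
have [->|/set0Pn[v vC]] := eqVneq C set0.
  rewrite preimset0 !inE; apply/existsP/existsP => [] [u /eqP/setP/(_ u)];
  by rewrite !inE connect0.
have gvC : g v \in g @^-1: C by rewrite inE gK.
rewrite (cluster_configsP _ gvC) (cluster_configsP _ vC).
apply/eqP/eqP => [|<-]; last by apply/setP => z; rewrite !inE connect_image gK.
move=> defC; apply/setP => z; have /setP/(_ (g z)) := defC.
by rewrite !inE gK connect_image => ->.
Qed.

End Automorphism.

End Configurations.

(** * The bunkbed of a complete graph *)

Section CompleteBunkbed.

Variable n : nat.

Local Notation V := ('I_n * bool)%type.
Local Notation K := (bunkbed_rel (@complete_rel n)).

Implicit Types (C : {set V}) (w : config K) (f : edge K) (x y z : 'I_n) (i : bool).

Lemma bunkbed_completeE (u v : V) :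
  K u v = (u.1 != v.1) && (u.2 == v.2) || (u.1 == v.1) && (u.2 != v.2).
Proof. by []. Qed.

Lemma bunkbed_complete_sym : symmetric K.
Proof.
by move=> u v; rewrite !bunkbed_completeE (eq_sym u.1) (eq_sym u.2).
Qed.
Local Notation K_sym := bunkbed_complete_sym.

(** The level exchange above Y.  For Y = setT it is an automorphism of the
    bunkbed; for Y = [set y] it is not, but taking preimages under it moves the
    copy of y in a set C to the other level. *)
Definition turn (Y : {set 'I_n}) (u : V) : V := (u.1, u.2 (+) (u.1 \in Y)).

Lemma turnK Y : involutive (turn Y).
Proof. by case=> z i; rewrite /turn /= addbK. Qed.

Lemma bunkbed_turnT u v : K (turn setT u) (turn setT v) = K u v.
Proof.
by rewrite !bunkbed_completeE /turn /= !inE; case: u v => [z []] [z' []].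
Qed.

Definition slice C i : {set 'I_n} := [set z | (z, i) \in C].

Definition level C i : {set V} := [set u in C | u.2 == i].

(** The ends inside C of the vertical edges leaving C. *)
Definition unpaired C : {set V} := [set u in C | turn setT u \notin C].

Definition rungs C : {set edge K} :=
  [set f : edge K | (val f \subset C)
     && [exists z, val f == [set (z, false); (z, true)]]].

Definition sealed C : {set config K} :=
  [set w : config K | [forall f in cut K C, ~~ w f] && [exists f in rungs C, w f]].

(** The two products count the horizontal edges leaving C, level by level. *)
Lemma card_cut_bunkbed C :
  #|cut K C| = #|slice C false| * (n - #|slice C false|)
           + #|slice C true| * (n - #|slice C true|) + #|unpaired C|.
Proof.
rewrite (card_cut K_sym).
pose P := [set p : V * V | [&& p.1 \in C, p.2 \notin C & K p.1 p.2]].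
rewrite -/P.
pose horizontal := [set p : V * V | p.1.2 == p.2.2].
have card_horizontal i :
    #|slice C i| * (n - #|slice C i|) = #|[set p in P :&: horizontal | p.1.2 == i]|.
  have -> : n - #|slice C i| = #|~: slice C i|.
    by rewrite [RHS]cardsCs setCK card_ord.
  rewrite -cardsX.
  rewrite -(@card_imset _ _ (fun p => ((p.1, i), (p.2, i)))); last first.
    by move=> [a b] [c d] /= [-> ->].
  apply: eq_card => [[[a k] [b l]]]; rewrite !inE /=; apply/imsetP/idP.
    move=> [[c d]]; rewrite !inE /= => /andP[cC dC] [-> -> -> ->].
    rewrite cC dC bunkbed_completeE /= !eqxx !andbT andbF orbF.
    by apply: contra dC => /eqP<-.
  case/andP=> [/andP[/and3P[aC bC _] /eqP kl /eqP ki]]; exists (a, b).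
    by rewrite !inE /= -{1}ki aC -ki kl bC.
  by rewrite -kl ki.
rewrite !card_horizontal -(cardsID horizontal P); congr (_ + _).
  rewrite -(cardsID [set p : V * V | p.1.2 == false] (P :&: horizontal)).
  congr (_ + _); apply: eq_card => p; rewrite !inE;
    by case: p.1.2; rewrite ?andbT ?andbF.
rewrite -(@card_imset _ _ (fun u => (u, turn setT u))); last by move=> u v [].
apply: eq_card => [[[a i] [b j]]]; rewrite !inE bunkbed_completeE /=.
apply/idP/imsetP.
  case/andP=> ij /and3P[aC bC]; rewrite (negbTE ij) andbF /= => /andP[/eqP ab _].
  have def_j : j = i (+) true by case: i j ij {aC bC} => [] [].
  by subst b; exists (a, i); rewrite ?inE /turn /= ?inE ?aC -?def_j ?bC.
case=> [[c k]]; rewrite inE => /andP[cC]; rewrite /turn /= inE => kC [-> -> -> ->].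
by rewrite cC kC eqxx; case: k {cC kC}; rewrite /= ?orbT ?andbT.
Qed.

Lemma cut_rungs_disjoint C : [disjoint cut K C & rungs C].
Proof.
apply/pred0P => f; rewrite /= !inE; apply/negP.
case/and3P=> /exists_inP[u _ /exists_inP[v]]; rewrite inE => vC /eqP->.
by move/subsetP/(_ v (set22 u v)); rewrite (negbTE vC).
Qed.

Lemma card_sealed C :
  #|sealed C|
    = 2 ^ #|~: cut K C| - 2 ^ (#|~: cut K C| - #|rungs C|).
Proof.
have disj := cut_rungs_disjoint C.
have -> : #|~: cut K C| - #|rungs C| = #|~: (cut K C :|: rungs C)|.
  have := cardsC (cut K C); have := cardsC (cut K C :|: rungs C).
  by rewrite cardsU (disjoint_setI0 disj) cards0; lia.
rewrite -!card_zero_on -cardsDS; last first.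
  apply/subsetP => w; rewrite !inE => /forall_inP wZ; apply/forall_inP => f fC.
  by apply: wZ; rewrite inE fC.
apply: eq_card => w; rewrite !inE [RHS]andbC; apply: andb_id2l => /forall_inP wC.
rewrite negb_forall_in; apply/exists_inP/exists_inP => [[f fR wf]|[f]].
  by exists f; rewrite ?wf // inE fR orbT.
rewrite inE => /orP[fC|fR] /negPn wf; last by exists f.
by rewrite (negbTE (wC f fC)) in wf.
Qed.

(** No edge leaving C and no rung has both ends in one level of C. *)
Lemma sealed_flip C i w : w \in sealed C -> flip_inside (level C i) w \in sealed C.
Proof.
rewrite !inE => /andP[/forall_inP wC /exists_inP[f fR wf]]; apply/andP; split.
  apply/forall_inP => h hC; rewrite ffunE (negbTE (wC h hC)) /=.
  move: hC; rewrite inE => /exists_inP[u _ /exists_inP[v vC /eqP->]].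
  by apply/subsetP => /(_ v (set22 u v)); move: vC; rewrite !inE => /negbTE->.
apply/exists_inP; exists f => //; rewrite ffunE wf /=.
move: fR; rewrite inE => /andP[_ /existsP[z /eqP->]].
apply/subsetP => sub; have := sub _ (set21 _ _); have := sub _ (set22 _ _).
by rewrite !inE; case: i {sub}; rewrite !andbF.
Qed.

Lemma level_clique C i : {in level C i &, forall u v, u != v -> K u v}.
Proof.
move=> [a k] [b l]; rewrite !inE /= => /andP[_ /eqP->] /andP[_ /eqP->].
rewrite bunkbed_completeE /= eqxx andbT andbF orbF.
by apply: contra => /eqP->.
Qed.

(** The open rung glues the two connected levels together. *)
Lemma joined_levels_cluster C w :
    w \in sealed C -> joined (level C false) w -> joined (level C true) w ->
  w \in cluster_configs K C.
Proof.
rewrite inE => /andP[/forall_inP wC /exists_inP[f fR wf]].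
move=> /joined_connect j0 /joined_connect j1.
move: fR; rewrite inE => /andP[/subsetP fC /existsP[z /eqP def_f]].
have z0C : (z, false) \in C by apply: fC; rewrite def_f set21.
have z1C : (z, true) \in C by apply: fC; rewrite def_f set22.
apply: (in_cluster_configs z0C) => // [[a i]] aC.
case: i aC => aC; last by apply: j0; rewrite inE ?z0C ?aC.
apply: (@connect_trans _ _ (z, true)); last by apply: j1; rewrite inE ?z1C ?aC.
by apply: connect1; apply/existsP; exists f; rewrite def_f eqxx.
Qed.

(** Each level in turn costs a factor of 2: half of the configurations under
    consideration, up to a flip inside that level, have it connected. *)
Lemma sealed_le_clusters C : #|sealed C| <= 4 * #|cluster_configs K C|.
Proof.
pose F i := flip_inside (e := K) (level C i).
pose J i := [set w : config K | joined (level C i) w].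
have F_inj i : injective (F i) := inv_inj (flip_insideK (level C i)).
have le0 : #|sealed C| <= 2 * #|sealed C :&: J false|.
  apply: (card_le_double (F_inj false)) => w wF; first exact: sealed_flip.
  by rewrite !inE; apply: joined_flip => //; [exact: K_sym | exact: level_clique].
have le1 : #|sealed C :&: J false| <= 2 * #|sealed C :&: J false :&: J true|.
  apply: (card_le_double (F_inj true)) => w; rewrite in_setI => /andP[wF w0].
    rewrite in_setI sealed_flip //= inE joined_flip_disjoint.
      by rewrite inE in w0.
    by apply/pred0P => u; rewrite /= !inE; case: (u.2); rewrite /= ?andbF.
  by rewrite !inE; apply: joined_flip => //; [exact: K_sym | exact: level_clique].
have : #|sealed C :&: J false :&: J true| <= #|cluster_configs K C|.
  apply/subset_leq_card/subsetP => w; rewrite 2!in_setI => /andP[/andP[wF]].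
  rewrite !inE => w0 w1; have := joined_levels_cluster wF w0 w1; by rewrite inE.
lia.
Qed.

(** An open path between the two levels of a cluster has to use an open rung,
    and this rung lies inside the cluster. *)
Lemma clusters_le_sealed C :
    slice C false != set0 -> slice C true != set0 ->
  #|cluster_configs K C| <= #|sealed C|.
Proof.
move=> /set0Pn[x]; rewrite inE => xC /set0Pn[y]; rewrite inE => yC.
apply/subset_leq_card/subsetP => w wC; rewrite inE; apply/andP; split.
  by apply/forall_inP => f; apply: cluster_cut_closed wC.
move: wC; rewrite (cluster_configsP _ xC) => /eqP defC.
apply: contraT; rewrite negb_exists_in => /forall_inP norung.
suff clos : closed (open_rel w) [pred u | (u \in C) && ~~ u.2].
  have := yC; rewrite -defC inE => /(closed_connect clos).
  by rewrite !inE /= xC yC.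
apply: intro_closed; first exact: connect_open_sym.
move=> [a i] [b j] /= ab; rewrite !inE /= => /andP[aC i0].
have bC : (b, j) \in C.
  rewrite -defC inE; apply: connect_trans (connect1 ab).
  by rewrite -defC inE in aC.
rewrite bC /=; apply/negP => j1; case/existsP: ab => f /andP[/eqP def_f wf].
suff fR : f \in rungs C by have := norung f fR; rewrite wf.
have := edge_ends K_sym def_f; rewrite bunkbed_completeE /= (negbTE i0) j1.
case/orP=> /andP[] // /eqP ab _.
rewrite inE def_f; apply/andP; split.
  by apply/subsetP => u; rewrite !inE => /orP[]/eqP->.
by apply/existsP; exists a; rewrite ab; move: i0 j1; case: (i) (j) => [] [].
Qed.

Lemma rungs_turn y C i :
  (y, i) \in C -> (y, ~~ i) \notin C -> rungs (turn [set y] @^-1: C) = rungs C.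
Proof.
move=> yC yNC; apply/setP => f; rewrite !inE andbC [RHS]andbC.
apply: andb_id2l => /existsP[z /eqP->].
have sub2 (D : {set V}) : ([set (z, false); (z, true)] \subset D)
    = ((z, false) \in D) && ((z, true) \in D).
  by rewrite subUset !sub1set.
rewrite !sub2 !inE /turn /= !inE; have [->|//] := eqVneq z y.
by case: i yC yNC => /= yC yNC; rewrite yC (negbTE yNC).
Qed.

Lemma card_unpaired_turn Y C : #|unpaired (turn Y @^-1: C)| = #|unpaired C|.
Proof.
rewrite -[RHS](card_preimset _ (inv_inj (turnK Y))); apply: eq_card => u.
suff turnC : turn Y (turn setT u) = turn setT (turn Y u) by rewrite !inE turnC.
by rewrite /turn /= !inE addbAC.
Qed.

Lemma slice_turn_from y C i :
  (y, i) \in C -> (y, ~~ i) \notin C ->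
  #|slice C i| = #|slice (turn [set y] @^-1: C) i|.+1.
Proof.
move=> yC yNC; rewrite (cardsD1 y) inE yC; congr _.+1; apply: eq_card => z.
rewrite !inE /turn /= !inE; have [->|//] := eqVneq z y.
  by rewrite addbT (negbTE yNC).
by rewrite addbF.
Qed.

Lemma slice_turn_to y C i :
  (y, i) \in C -> (y, ~~ i) \notin C ->
  #|slice (turn [set y] @^-1: C) (~~ i)| = #|slice C (~~ i)|.+1.
Proof.
move=> yC yNC; rewrite (cardsD1 y) !inE /turn /= !inE eqxx addbT negbK yC.
congr _.+1; apply: eq_card => z; rewrite !inE.
by have [->|] := eqVneq z y; rewrite /= ?(negbTE yNC) ?addbF.
Qed.

(** The horizontal part a(n - a) + b(n - b) of the cut, where a <= b count the
    vertices of C at levels i and ~~ i, becomes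
    (a - 1)(n - a + 1) + (b + 1)(n - b - 1), which is less by 2(b + 1 - a). *)
Lemma cut_turn y C i (d := #|slice C (~~ i)|.+1 - #|slice C i|) :
    (y, i) \in C -> (y, ~~ i) \notin C -> #|slice C i| <= #|slice C (~~ i)| ->
  #|cut K (turn [set y] @^-1: C)| + 2 * d = #|cut K C|.
Proof.
move=> yC yNC le_i; have from := slice_turn_from yC yNC.
have to := slice_turn_to yC yNC; rewrite !card_cut_bunkbed card_unpaired_turn.
have le_n (D : {set 'I_n}) : #|D| <= n by rewrite -[n in _ <= n]card_ord max_card.
have := le_n (slice (turn [set y] @^-1: C) (~~ i)).
have := le_n (slice (turn [set y] @^-1: C) i).
have := le_n (slice C (~~ i)); have := le_n (slice C i).
rewrite /d; case: (i) yC yNC le_i from to => /= _ _; nia.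
Qed.

(** A configuration sealed by C amounts to a non-empty set of rungs and an
    arbitrary set of the other edges outside the cut.  With the same rungs,
    making the cut smaller by one edge therefore doubles the number of
    configurations. *)
Lemma sealed_mul_le C D k :
    rungs D = rungs C -> #|cut K D| + k <= #|cut K C| ->
  2 ^ k * #|sealed C| <= #|sealed D|.
Proof.
move=> eqR le_cut; rewrite !card_sealed eqR.
have le_r : #|rungs C| <= #|~: cut K C|.
  by rewrite subset_leq_card // -disjoints_subset disjoint_sym cut_rungs_disjoint.
have : #|~: cut K C| + k <= #|~: cut K D|.
  by have := cardsC (cut K C); have := cardsC (cut K D); lia.
move: le_r; move: #|rungs C| #|~: cut K C| #|~: cut K D|.
move=> r E E' le_rE le_EE'.
have powB m : r <= m -> 2 ^ m - 2 ^ (m - r) = (2 ^ r - 1) * 2 ^ (m - r).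
  by move=> le_rm; rewrite mulnBl mul1n -expnD subnKC.
rewrite !powB; [|lia..].
by rewrite mulnCA leq_mul2l -expnD leq_exp2l //; apply/orP; right; lia.
Qed.

(** The cut loses at least 2 edges, which gains the factor 4 that is lost
    between sealed configurations and clusters.  If the target level is already
    the larger one, the cut loses at least 4 edges, of which 3 suffice to gain
    a further factor of 2. *)
Lemma clusters_turn y C i :
    (y, i) \in C -> (y, ~~ i) \notin C -> #|slice C i| <= #|slice C (~~ i)| ->
  (#|slice C i| < #|slice C (~~ i)|).+1 * #|cluster_configs K C|
    <= #|cluster_configs K (turn [set y] @^-1: C)|.
Proof.
move=> yC yNC le_i; set D := turn _ @^-1: C.
have slice0 j : slice C j != set0.
  have: 0 < #|slice C i| by apply/card_gt0P; exists y; rewrite inE.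
  rewrite -card_gt0; case: (i) (j) le_i => [] [] /=; lia.
have leC := clusters_le_sealed (slice0 false) (slice0 true).
have leD := sealed_le_clusters D.
have := cut_turn yC yNC le_i; rewrite -/D.
have [lt_i|ge_i] := ltnP => cutD.
  have : 2 ^ 3 * #|sealed C| <= #|sealed D|.
    by apply: sealed_mul_le; [exact: rungs_turn yC yNC | lia].
  lia.
have : 2 ^ 2 * #|sealed C| <= #|sealed D|.
  by apply: sealed_mul_le; [exact: rungs_turn yC yNC | lia].
lia.
Qed.

(** If one level of C is larger than the other, moving a vertex to it doubles
    the count, which pays for both sides; if they are of equal size, neither
    move decreases the count. *)
Lemma clusters_convex x y C :
    (x, false) \in C -> (x, true) \notin C ->
    (y, true) \in C -> (y, false) \notin C ->
  2 * #|cluster_configs K C|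
    <= #|cluster_configs K (turn [set x] @^-1: C)|
     + #|cluster_configs K (turn [set y] @^-1: C)|.
Proof.
move=> x0 x1 y1 y0; have cx := @clusters_turn x C false x0 x1.
have cy := @clusters_turn y C true y1 y0; move: cx cy => /=.
by case: ltngtP; lia.
Qed.

Definition pattern x y (a b c d : bool) (C : {set V}) :=
  [&& ((x, false) \in C) == a, ((x, true) \in C) == b,
      ((y, false) \in C) == c & ((y, true) \in C) == d].

Definition pattern_sum x y (a b c d : bool) :=
  \sum_(C : {set V} | pattern x y a b c d C) #|cluster_configs K C|.

Lemma preimset_turn_inj Y : injective (fun C => turn Y @^-1: C).
Proof.
apply: (can_inj (g := fun C => turn Y @^-1: C)) => C.
by apply/setP => u; rewrite !inE turnK.
Qed.

Lemma pattern_sum_flip x y a b c d :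
  pattern_sum x y a b c d = pattern_sum x y b a d c.
Proof.
rewrite /pattern_sum (reindex_inj (@preimset_turn_inj setT)); apply: eq_big => C.
  rewrite /pattern !inE /turn /= !inE /=.
  by rewrite andbCA; congr (_ && (_ && _)); rewrite andbC.
by move=> _; apply: (card_cluster_configs_image K_sym (turnK setT) bunkbed_turnT).
Qed.

(** Sum clusters_convex over the sets containing just (x,0) and (y,1) among the
    copies of x and y.  Moving x leads to the sets with (x,1) and (y,1), hence,
    by the level exchange, to the same sum as moving y. *)
Lemma pattern_sum_same_level_ge x y : x != y ->
  pattern_sum x y true false false true <= pattern_sum x y true false true false.
Proof.
move=> ne_xy; rewrite -(leq_pmul2l (isT : 0 < 2)).
have sumx : pattern_sum x y true false true false =
    \sum_(C | pattern x y true false false true C)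
       #|cluster_configs K (turn [set x] @^-1: C)|.
  rewrite pattern_sum_flip /pattern_sum (reindex_inj (@preimset_turn_inj [set x])).
  apply: eq_bigl => C; rewrite /pattern !inE /turn /= !inE /= eqxx.
  by rewrite (eq_sym y) (negbTE ne_xy) andbCA.
have sumy : pattern_sum x y true false true false =
    \sum_(C | pattern x y true false false true C)
       #|cluster_configs K (turn [set y] @^-1: C)|.
  rewrite /pattern_sum (reindex_inj (@preimset_turn_inj [set y])).
  apply: eq_bigl => C; rewrite /pattern !inE /turn /= !inE /= eqxx.
  by rewrite (negbTE ne_xy) /= [X in _ && (_ && X)]andbC.
rewrite [X in _ <= X]mul2n -[X in _ <= X]addnn {1}sumx sumy -big_split big_distrr.
apply: leq_sum => C /and4P[/eqP x0 /eqP x1 /eqP y0 /eqP y1].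
by apply: clusters_convex; rewrite ?x0 ?x1 ?y0 ?y1.
Qed.

Lemma card_connected_pattern x y i :
  #|@connected_in _ K (x, false) (y, i)| =
  \sum_(b : bool) \sum_(d : bool)
     (if i then pattern_sum x y true b d true else pattern_sum x y true b true d).
Proof.
rewrite card_connected (partition_big (fun C => (x, true) \in C) predT) //=.
apply: eq_bigr => b _.
rewrite (partition_big (fun C => (y, ~~ i) \in C) predT) //=.
apply: eq_bigr => d _; case: i => /=; apply: eq_bigl => C; rewrite /pattern;
  do 4 case: (_ \in C); case: b; case: d => //.
Qed.

Lemma card_connected_le x y :
  #|@connected_in _ K (x, false) (y, true)|
    <= #|@connected_in _ K (x, false) (y, false)|.
Proof.
have [->|ne_xy] := eqVneq x y.
  by apply/subset_leq_card/subsetP => w _; rewrite unfold_in /= connect0.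
rewrite !card_connected_pattern !big_bool /=.
have := pattern_sum_same_level_ge ne_xy.
rewrite (pattern_sum_flip x y true true false true); lia.
Qed.

End CompleteBunkbed.

(** * Probability one half and the conclusion *)

Local Open Scope ring_scope.

Lemma perc_prob_half (R : realFieldType) (T : finType) (e : rel T)
    (A : pred (config e)) :
  perc_prob (2^-1 : R) A = (#|A|)%:R * 2^-1 ^+ #|edge e|.
Proof.
have half : 1 - 2^-1 = 2^-1 :> R by field.
rewrite /perc_prob mulr_natl -sumr_const; apply: eq_bigr => w _.
rewrite /perc_weight -prodr_const; apply: eq_bigr => f _.
by rewrite half if_same.
Qed.

Theorem theorem1p1 (R : realFieldType) (n : nat) (hn : (1 <= n)%N)
    (x y : 'I_n) :
  perc_prob (2^-1 : R)
    (connected_in (e := bunkbed_rel (@complete_rel n)) (x, false) (y, false)) >=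
  perc_prob (2^-1 : R)
    (connected_in (e := bunkbed_rel (@complete_rel n)) (x, false) (y, true)).
Proof.
rewrite !perc_prob_half ler_wpM2r ?exprn_ge0 ?invr_ge0 ?ler0n //.
by rewrite ler_nat card_connected_le.
Qed.
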